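(* For $n\ge 1$ let $S_n=\frac{1}{n+1}\binom{2n}{n}$ and let $J^n_1,\dots,J^n_{S_n}$ be the $n$-iterates of a binary operation $V$. Let $N_n$ be the number of ordered pairs $(i,j)$, $1\le i,j\le S_n$, such that the identity $J^n_i=J^n_j$ is formally irreducible (with respect to the tableau $A_n\oplus B_n$). ($N_n$ is the number of algebras defined by a binary operation satisfying a formally irreducible identity between two $n$-iterates of the operation, one algebra being counted for each such identity.) Then, as $n\to\infty$, $$N_n = O\!\left(\left|\frac{n+2}{n}\,e^{-n/16}-\frac{2}{n}\right| S_n^{2}\right).$$
   Context: Let $V$ be a formal binary operation symbol. An $n$-iterate of $V$ is a formal expression obtained by fully parenthesizing the word $x_1x_2\cdots x_{n+1}$ with $n$ applications of $V$, where the variables occur in this order, each exactly once. Equivalently, it is a full binary tree with $n$ internal nodes and $n+1$ leaves, labelled $x_1,\dots,x_{n+1}$ from left to right. There are $S_n=\frac{1}{n+1}\binom{2n}{n}$ (the $n$th Catalan number) $n$-iterates, denoted $J^n_1,\dots,J^n_{S_n}$. The only $0$-iterate is the single variable $x_1$. Tableau $A_n$ has $n$ lines $L_1,\dots,L_n$. Line $L_i$ consists of the $S_{n-1}$ $n$-iterates $$J^{n-1}_p(x_1,\dots,x_{i-1},V(x_i,x_{i+1}),x_{i+2},\dots,x_{n+1}),\qquad p=1,\dots,S_{n-1},$$ that is, the $n$-iterates in which $V(x_i,x_{i+1})$ occurs as a subexpression. Tableau $B_n$ has two lines. One consists of the $n$-iterates $V(x_1,J^{n-1}_p(x_2,\dots,x_{n+1}))$,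 $p=1,\dots,S_{n-1}$, and the other of the $n$-iterates $V(J^{n-1}_p(x_1,\dots,x_n),x_{n+1})$, $p=1,\dots,S_{n-1}$. Tableau $A_n\oplus B_n$ has the $n+2$ lines of $A_n$ and $B_n$ taken together. An identity of order $n$ is an expression $J^n_i=J^n_j$ with $1\le i,j\le S_n$. Identities are counted as ordered pairs $(i,j)$, with $i=j$ allowed, so there are $S_n^2$ of them. The identity $J^n_i=J^n_j$ is formally reducible (with respect to $A_n\oplus B_n$) if some line of $A_n\oplus B_n$ contains both $J^n_i$ and $J^n_j$. Otherwise it is formally irreducible. *)

(* Defs.v *)
From HB Require Import structures.
From mathcomp Require Import all_boot all_order all_algebra.
From mathcomp Require Import all_classical all_reals all_analysis.

Set Implicit Arguments.
Unset Strict Implicit.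
Unset Printing Implicit Defensive.

Inductive term : Type := X of nat | V of term & term.

Fixpoint tree_of_term (t : term) : GenTree.tree nat :=
  match t with
  | X i => GenTree.Leaf i
  | V a b => GenTree.Node 0 [:: tree_of_term a; tree_of_term b]
  end.

Fixpoint term_of_tree (t : GenTree.tree nat) : option term :=
  match t with
  | GenTree.Leaf i => Some (X i)
  | GenTree.Node _ [:: a; b] =>
      if (term_of_tree a, term_of_tree b) is (Some a', Some b')
      then Some (V a' b') else None
  | _ => None
  end.

Lemma tree_of_termK : pcancel tree_of_term term_of_tree.
Proof. by elim=> //= a -> b ->. Qed.

HB.instance Definition _ := Countable.copy term (pcan_type tree_of_termK).

(* The word of variables of a term, read from left to right. *)
Fixpoint leaves (t : term) : seq nat :=
  match t with
  | X i => [:: i]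
  | V a b => leaves a ++ leaves b
  end.

(* t is a full parenthesization of the word x_1 x_2 ... x_(n+1); the number of
   applications of V in such a term is automatically n. *)
Definition is_iterate (n : nat) (t : term) : bool := leaves t == iota 1 n.+1.

Definition iterate (n : nat) : Type := {t : term | is_iterate n t}.
HB.instance Definition _ n := Countable.on (iterate n).
HB.instance Definition _ n := SubType.on (iterate n).

(* All terms of height at most d in the variables of w; only used to show that
   there are finitely many n-iterates. *)
Fixpoint bounded_terms (w : seq nat) (d : nat) : seq term :=
  map X w ++
  (if d is d'.+1 then
     [seq V a b | a <- bounded_terms w d', b <- bounded_terms w d']
   else [::]).

Lemma leaves_gt0 t : 0 < size (leaves t).
Proof. by elim: t => //= a IHa b IHb; rewrite size_cat addn_gt0 IHa. Qed.

Lemma mem_bounded_terms w d t :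
  {subset leaves t <= w} -> size (leaves t) <= d.+1 -> t \in bounded_terms w d.
Proof.
elim: t d => [i|a IHa b IHb] d sub_w le_d.
  have wi : i \in w by apply: sub_w; rewrite inE.
  by case: d {le_d} => [|d] /=; rewrite mem_cat (map_f X wi).
move: le_d; rewrite /= size_cat => le_d.
have a0 := leaves_gt0 a; have b0 := leaves_gt0 b.
case: d le_d => [|d] le_d.
  by have := leq_trans (leq_add a0 b0) le_d.
rewrite /= mem_cat; apply/orP; right; apply: allpairs_f.
- apply: IHa => [x xa|]; first by apply: sub_w; rewrite mem_cat xa.
  rewrite -(leq_add2r 1) addn1 addn1 -addn1.
  by apply: leq_trans le_d; rewrite leq_add2l.
- apply: IHb => [x xb|]; first by apply: sub_w; rewrite mem_cat xb orbT.
  rewrite -(leq_add2l 1) add1n add1n.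
  by apply: leq_trans le_d; rewrite -add1n leq_add2r.
Qed.

Definition iterate_enum (n : nat) : seq (iterate n) :=
  pmap insub (undup (bounded_terms (iota 1 n.+1) n)).

Lemma iterate_enumP n : Finite.axiom (iterate_enum n).
Proof.
move=> t; rewrite count_uniq_mem ?pmap_sub_uniq ?undup_uniq //.
rewrite mem_pmap_sub mem_undup mem_bounded_terms //.
- by move=> x; rewrite (eqP (valP t)).
- by rewrite (eqP (valP t)) size_iota.
Qed.

HB.instance Definition _ n := fintype.isFinite.Build (iterate n) (@iterate_enumP n).

(* J(y 1, y 2, ...): simultaneous substitution of y i for x_i. *)
Fixpoint subst (y : nat -> term) (t : term) : term :=
  match t with
  | X i => y i
  | V a b => V (subst y a) (subst y b)
  end.

(* The arguments (x_1, ..., x_(i-1), V(x_i, x_(i+1)), x_(i+2), ...). *)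
Definition merge_at (i j : nat) : term :=
  if j < i then X j else if j == i then V (X i) (X i.+1) else X j.+1.

(* The tableaux are meant for n >= 1, so that n.-1 is n - 1. *)
Definition lineA (n i : nat) : {set iterate n} :=
  [set t | [exists s : iterate n.-1, val t == subst (merge_at i) (val s)]].

Definition lineBl (n : nat) : {set iterate n} :=
  [set t | [exists s : iterate n.-1,
     val t == V (X 1) (subst (fun j => X j.+1) (val s))]].

Definition lineBr (n : nat) : {set iterate n} :=
  [set t | [exists s : iterate n.-1, val t == V (val s) (X n.+1)]].

Definition tableauA (n : nat) : seq {set iterate n} :=
  [seq lineA n i | i <- iota 1 n].

Definition tableauB (n : nat) : seq {set iterate n} := [:: lineBl n; lineBr n].

Definition tableauAB (n : nat) : seq {set iterate n} :=
  tableauA n ++ tableauB n.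

Definition formally_reducible (n : nat) (J K : iterate n) : bool :=
  has (fun L : {set iterate n} => (J \in L) && (K \in L)) (tableauAB n).

Definition formally_irreducible (n : nat) (J K : iterate n) : bool :=
  ~~ formally_reducible J K.

Definition num_irreducible (n : nat) : nat :=
  #|[set p : iterate n * iterate n | formally_irreducible p.1 p.2]|.

Definition catalan (R : realType) (n : nat) : R :=
  (n.+1%:R^-1 * 'C(2 * n, n)%:R)%R.

(* Main.v *)
Require Import Defs.
From HB Require Import structures.
From mathcomp Require Import all_boot all_order all_algebra.
From mathcomp Require Import all_classical all_reals all_analysis.
From mathcomp Require Import zify ring lra.

(** An irreducible pair [(J, K)] has no line [L_i] of the tableau A in common.
    For uniform independent [J] and [K], the number [Z] of common lines [L_i]
    has mean [n p^2] with [p = S_(n-1) / S_n], since a line has [S_(n-1)]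
    elements; two lines [L_i], [L_j] with [|i - j| >= 2] share at most [S_(n-2)]
    elements, and [S_n S_(n-2) / S_(n-1)^2 = 1 + O(1/n^2)], so the variance of
    [Z] is [O(n)].  Chebyshev's inequality gives [P(Z = 0) = O(1/n)], while the
    factor [|(n+2)/n e^(-n/16) - 2/n|] is at least [1/n] for large [n]. *)

Set Implicit Arguments.
Unset Strict Implicit.
Unset Printing Implicit Defensive.

Import Order.TTheory GRing.Theory Num.Theory.
Import numFieldNormedType.Exports.

(** * Catalan numbers *)

(* [d] is recursion fuel: the enumeration is only correct when [n <= d]. *)
Fixpoint trees (d m n : nat) : seq term :=
  match n with
  | 0 => [:: X m]
  | n'.+1 =>
    if d is d'.+1 then
      flatten [seq [seq V a b | a <- trees d' m i,
                                b <- trees d' (m + i.+1) (n' - i)]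
              | i <- iota 0 n]
    else [::]
  end.

Lemma treesS d m n : trees d.+1 m n.+1 =
  flatten [seq [seq V a b | a <- trees d m i, b <- trees d (m + i.+1) (n - i)]
          | i <- iota 0 n.+1].
Proof. by []. Qed.

Lemma mem_trees d m n t : n <= d -> (t \in trees d m n) = (leaves t == iota m n.+1).
Proof.
elim: d m n t => [|d IHd] m [|n] t // le_nd.
1,2: rewrite inE; case: t => [k|a b] /=; first by apply/eqP/eqP => [[->]|[->]].
1,2: apply/esym/negbTE/eqP => /(congr1 size); rewrite size_cat /=.
1,2: by have := leaves_gt0 a; have := leaves_gt0 b; lia.
rewrite treesS.
apply/flatten_mapP/eqP => [[i] | ].
  rewrite mem_iota => /andP[_ lt_i].
  move=> /allpairsP[[a b] /= []]; rewrite !IHd; try lia.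
  move=> /eqP la /eqP lb ->; rewrite [leaves _]/= la lb -iotaD.
  by rewrite addSn addnS subnKC.
case: t => [k|a b] // eq_l; move: (leaves_gt0 a) (leaves_gt0 b) => a0 b0.
have sz : size (leaves a) + size (leaves b) = n.+2.
  by rewrite -size_cat -[_ ++ _]/(leaves (V a b)) eq_l size_iota.
exists (size (leaves a)).-1; first by rewrite mem_iota; lia.
have eqn : n.+2 = size (leaves a) + size (leaves b) by lia.
move: eq_l; rewrite [leaves _]/= eqn iotaD => /eqP; rewrite eqseq_cat ?size_iota // => /andP[la lb].
apply: allpairs_f; rewrite IHd; try lia.
  by rewrite prednK.
by move: lb; rewrite prednK //; congr (_ == iota _ _); lia.
Qed.

(** The number of leaves of the left subtree recovers the split index [i], so the lists joined by
    [flatten] are pairwise disjoint. *)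
Lemma trees_uniq d m n : n <= d -> uniq (trees d m n).
Proof.
elim: d m n => [|d IHd] m [|n] // le_nd; rewrite treesS.
set F := fun i => [seq V a b | a <- _, b <- _].
have -> : flatten [seq F i | i <- iota 0 n.+1] = [seq t | i <- iota 0 n.+1, t <- F i].
  by congr flatten; apply: eq_map => i; rewrite map_id.
apply: allpairs_uniq_dep; first exact: iota_uniq.
  move=> i; rewrite mem_iota => /andP[_ lt_i].
  apply: allpairs_uniq; try by apply: IHd; lia.
  by move=> [a b] [c e] _ _ /= [-> ->].
have FP i t : i < n.+1 -> t \in F i -> exists a b, t = V a b /\ size (leaves a) = i.+1.
  move=> lt_i /allpairsP[[a b] /= [+ _ ->]]; rewrite mem_trees; last by lia.
  by move=> /eqP la; exists a, b; rewrite la size_iota.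
move=> _ _ /allpairsPdep[i [t [i_n tF ->]]] /allpairsPdep[j [u [j_n uF ->]]] /= tu.
move: i_n j_n; rewrite !mem_iota => i_n j_n.
have [a [b [et sa]]] := FP _ _ i_n tF; have [c [e [eu sc]]] := FP _ _ j_n uF.
have ij : i = j by move: tu; rewrite et eu => -[ac _]; move: sa; rewrite ac sc => -[].
by rewrite tu ij.
Qed.

(** The two recursive calls change both the fuel and the first label, so the count has to be freed
    from both. *)
Lemma size_trees d d' m m' n : n <= d -> n <= d' ->
  size (trees d m n) = size (trees d' m' n).
Proof.
elim: d d' m m' n => [|d IHd] [|d'] m m' [|n] // le_nd le_nd'.
rewrite !treesS !size_flatten /shape -!map_comp; congr sumn.
apply/eq_in_map => i; rewrite mem_iota => /andP[_ lt_i] /=.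
by rewrite !size_allpairs; congr muln; apply: IHd; lia.
Qed.

Lemma card_iterate d m n : n <= d -> #|{: iterate n}| = size (trees d m n).
Proof.
move=> le_nd; rewrite (size_trees m 1 le_nd (leqnn n)) cardE -(size_map val).
apply/perm_size/uniq_perm.
- by rewrite (map_inj_uniq val_inj) enum_uniq.
- exact: trees_uniq.
move=> t; rewrite mem_trees //; apply/mapP/idP => [[s _ ->]|t_it]; first exact: (valP s).
by exists (exist (is_iterate n) t t_it); rewrite ?mem_enum.
Qed.

Lemma card_iterate0 : #|{: iterate 0}| = 1.
Proof. by rewrite (@card_iterate 0 0). Qed.

(** Segner's recurrence for the Catalan numbers: split at the root according to the size of the left
    subtree. *)
Lemma card_iterateS n : #|{: iterate n.+1}| =
  \sum_(i < n.+1) #|{: iterate i}| * #|{: iterate (n - i)}|.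
Proof.
rewrite (card_iterate 0 (leqnn _)) treesS size_flatten /shape -map_comp sumnE big_map.
rewrite -[iota 0 n.+1]/(index_iota 0 n.+1) big_mkord.
apply: eq_bigr => i _ /=; have := ltn_ord i => i_n.
by rewrite size_allpairs -!card_iterate //; lia.
Qed.

(* Symmetrising the convolution gives 2 * sum (i+1) c_i c_(n-i) = (n+2) c_(n+1);
   the induction hypothesis turns the same sum into (2n+1) c_n. *)
Lemma card_iterate_rec n :
  n.+2 * #|{: iterate n.+1}| = (4 * n + 2) * #|{: iterate n}|.
Proof.
pose c n := #|{: iterate n}|.
have sym k (f : nat -> nat) :
    \sum_(i < k.+1) f i * (c i * c (k - i)) = \sum_(i < k.+1) f (k - i) * (c i * c (k - i)).
  rewrite (reindex_inj rev_ord_inj); apply: eq_bigr => i _ /=.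
  by rewrite subSS subKn 1?(mulnC (c i)) // -ltnS.
have dbl k : 2 * (\sum_(i < k.+1) i.+1 * (c i * c (k - i))) = k.+2 * c k.+1.
  rewrite mul2n -addnn {2}(sym k succn) -big_split /= /c card_iterateS big_distrr.
  by apply: eq_bigr => i _ /=; rewrite -mulnDl; congr muln; have := ltn_ord i; lia.
elim/ltn_ind: n => n IHn; rewrite -/(c _) -/(c _) -dbl.
case: n IHn => [|n] IHn; first by rewrite big_ord_recl big_ord0 /c card_iterate0.
rewrite big_ord_recl /= subn0 {1}/c card_iterate0.
have -> : \sum_(i < n.+1) (bump 0 i).+1 * (c (bump 0 i) * c (n.+1 - bump 0 i)) =
          \sum_(i < n.+1) (4 * i + 2) * (c i * c (n - i)).
  apply: eq_bigr => i _; rewrite /bump leq0n add1n subSS !mulnA; congr muln.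
  exact: IHn.
have e : \sum_(i < n.+1) (4 * i + 2) * (c i * c (n - i)) + 2 * c n.+1 =
   2 * (2 * (\sum_(i < n.+1) i.+1 * (c i * c (n - i)))).
  rewrite {3}/c card_iterateS !big_distrr -big_split /=.
  by apply: eq_bigr => i _; rewrite -/(c _) -/(c _) !mulnA -mulnDl; congr muln; lia.
by move: e; rewrite dbl; nia.
Qed.

Lemma card_iterateE n : n.+1 * #|{: iterate n}| = 'C(2 * n, n).
Proof.
elim: n => [|n IHn]; first by rewrite card_iterate0 muln0 bin0.
rewrite card_iterate_rec mulnS binS.
(* By symmetry of the odd row, the two terms of Pascal's rule for [C(2n+2, n+1)] are equal. *)
have binS1 : 'C(2 * n.+1.-1 + 1, n.+1) = 'C(2 * n.+1.-1 + 1, n).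
  by rewrite -bin_sub; [congr 'C(_, _) | ]; lia.
have := mul_bin_diag (2 * n + 1) n; rewrite addn1 /= -IHn.
move: binS1; rewrite /= addn1 => ->.
rewrite mulnCA => /eqP; rewrite eqn_pmul2l // => /eqP <-.
by lia.
Qed.

(** * The lines of the first tableau *)

Definition merge_word (i : nat) (w : seq nat) : seq nat :=
  flatten [seq leaves (merge_at i j) | j <- w].

Lemma leaves_subst_merge i t :
  leaves (subst (merge_at i) t) = merge_word i (leaves t).
Proof.
elim: t => [j|a IHa b IHb] /=; first by rewrite /merge_word /= cats0.
by rewrite IHa IHb /merge_word map_cat flatten_cat.
Qed.

Lemma merge_word_iota_ge i m k : i < m -> merge_word i (iota m k) = iota m.+1 k.
Proof.
elim: k m => [|k IHk] m lt_im //=.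
rewrite /merge_word /= -/(merge_word _ _) IHk; last by lia.
by rewrite /merge_at ltnNge (ltnW lt_im) /= gtn_eqF.
Qed.

Lemma merge_word_iota i m k : m <= i < m + k ->
  merge_word i (iota m k) = iota m k.+1.
Proof.
elim: k m => [|k IHk] m ik; first by lia.
rewrite /merge_word [iota m k.+1]/= /= -/(merge_word _ _).
have [lt_mi|le_im] := ltnP m i.
  by rewrite IHk /merge_at ?lt_mi //; lia.
have -> : m = i by lia.
by rewrite merge_word_iota_ge // /merge_at ltnn eqxx.
Qed.

Lemma merge_word_inj i : injective (merge_word i).
Proof.
(* Left inverse: delete the letter [i+1], then lower every letter above [i] by one. *)
pose f w := [seq if i < k then k.-1 else k | k <- w & k != i.+1].
have f_cat u v : f (u ++ v) = f u ++ f v by rewrite /f filter_cat map_cat.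
apply: (can_inj (g := f)); elim=> [|j w IHw] //.
rewrite /merge_word /= -/(merge_word _ _) f_cat IHw /f.
rewrite /merge_at; case: ltngtP => [lt|gt|->] /=.
- by rewrite ifT /= ?ifF //; lia.
- by rewrite ifT /= ?ifT //; lia.
- by rewrite eqxx ltn_eqF //= ltnn.
Qed.

Lemma is_iterate_merge n i t : 0 < i <= n ->
  is_iterate n (subst (merge_at i) t) = is_iterate n.-1 t.
Proof.
case: n => [|n] i_n; first by lia.
rewrite /is_iterate leaves_subst_merge -(@merge_word_iota i 1 n.+1); last by lia.
by rewrite (inj_eq (@merge_word_inj i)).
Qed.

Lemma subst_merge_eqX i t k : subst (merge_at i) t = X k ->
  exists2 j, t = X j & j != i /\ k = if j < i then j else j.+1.
Proof.
case: t => [j|a b] //=; rewrite /merge_at; case: ltngtP => // ji [<-].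
  by exists j => //; rewrite ji; split=> //; lia.
by exists j => //; rewrite ifF; [split=> //|]; lia.
Qed.

(** The only possible clash is between the leaf [X i], which becomes [V (X i) (X i.+1)], and a
    genuine node. It is excluded because no leaf is sent to [X i]. *)
Lemma subst_merge_inj i : injective (subst (merge_at i)).
Proof.
have neqV j a b : merge_at i j <> V (subst (merge_at i) a) (subst (merge_at i) b).
  rewrite /merge_at; case: ltngtP => // _ [/esym/subst_merge_eqX[k _ [ki e]] _].
  by move: e; case: ifP => lt; lia.
elim=> [j|a IHa b IHb] [k|c d] //=.
- rewrite /merge_at; case: ltngtP => jk; case: ltngtP => ki //=.
  1-4: by move=> e; congr X; (case: e => e || move: e => _); lia.
- by move/neqV.
- by move/esym/neqV.
- by case=> /IHa-> /IHb->.
Qed.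

(** For [i + 1 < j] the subterms [V(x_i, x_(i+1))] and [V(x_j, x_(j+1))] share no variable, so
    contracting the second leaves the first in place. *)
Lemma subst_merge_common i j s s' : i.+1 < j ->
  subst (merge_at j) s = subst (merge_at i) s' ->
  exists u, s = subst (merge_at i) u.
Proof.
move=> ij; elim: s s' => [k|a IHa b IHb] s' /=.
  move=> e; suff [/eqP ki /eqP kSi] : k != i /\ k != i.+1.
    exists (X (if k < i then k else k.-1)) => /=.
    have [lt_ki|le_ik] := ltnP k i; first by rewrite /merge_at lt_ki.
    by rewrite /merge_at ifF ?ifF; first congr X; lia.
  move: e; rewrite {1}/merge_at; case: ltngtP => kj e; try lia.
  have /esym/subst_merge_eqX[l _ [li]] := e; case: ifP; lia.
case: s' => [l|c d] /=; last first.
  by case=> /IHa[u ->] /IHb[v ->]; exists (V u v).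
rewrite {3}/merge_at; case: ltngtP => // _ [].
(* Here the node itself becomes [V(x_i, x_(i+1))]. As [i + 1 < j], the shift at [j] fixes both
   labels, so the node is the image of the leaf [X i]. *)
move=> /subst_merge_eqX[k -> [kj ki]] /subst_merge_eqX[k' -> [k'j k'i]].
exists (X i) => /=; rewrite /merge_at ltnn eqxx.
by move: ki k'i; case: ifP; case: ifP => *; congr (V (X _) (X _)); lia.
Qed.

Lemma subst_merge_is_iterate n i (in_n : 0 < i <= n) (s : iterate n.-1) :
  is_iterate n (subst (merge_at i) (val s)).
Proof. by rewrite is_iterate_merge // (valP s). Qed.

Definition merge_iterate n i (in_n : 0 < i <= n) (s : iterate n.-1) : iterate n :=
  exist (is_iterate n) _ (subst_merge_is_iterate in_n s).

Lemma merge_iterate_inj n i (in_n : 0 < i <= n) : injective (merge_iterate in_n).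
Proof. by move=> s s' [] /subst_merge_inj /val_inj. Qed.

Lemma lineAE n i (in_n : 0 < i <= n) :
  lineA n i = [set merge_iterate in_n s | s : iterate n.-1]%SET.
Proof.
apply/setP => t; rewrite inE; apply/existsP/imsetP => [[s /eqP e]|[s _ ->]].
  by exists s => //; apply: val_inj.
by exists s.
Qed.

Lemma card_lineA n i : 0 < i <= n -> #|lineA n i| = #|{: iterate n.-1}|.
Proof. by move=> in_n; rewrite (lineAE in_n) card_imset //; apply: merge_iterate_inj. Qed.

(** Contracting at [j], the larger index, keeps the labels [i] and [i+1]. The intersection thus lies
    in the injective image of line [i] one order lower. *)
Lemma card_lineAI n i j : 0 < i -> i.+1 < j -> j <= n ->
  #|lineA n i :&: lineA n j|%SET <= #|{: iterate n.-2}|.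
Proof.
move=> i0 ij jn; have jn' : 0 < j <= n by lia.
have in' : 0 < i <= n.-1 by lia.
rewrite -(card_lineA in') -(card_imset _ (@merge_iterate_inj n j jn')).
apply/subset_leq_card/fintype.subsetP => t; rewrite finset.in_setI => /andP[].
rewrite inE => /existsP[s' /eqP e']; rewrite (lineAE jn') => /imsetP[s _ e].
apply/imsetP; exists s => //; rewrite inE.
have [u us] : exists u, val s = subst (merge_at i) u.
  by apply: (subst_merge_common ij (s' := val s')); rewrite -e' e.
have u_it : is_iterate n.-2 u by rewrite -(is_iterate_merge _ in') -us (valP s).
by apply/existsP; exists (exist _ u u_it); rewrite us.
Qed.

(** * The second moment *)

Local Open Scope ring_scope.

(** The random variable [Z] for an abstract family of sets. Its sums over [p] are expectations
    multiplied by [#|T|^2]. *)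
Definition hits (R : realFieldType) (T : finType) (n : nat) (A : 'I_n -> {set T})
    (p : T * T) : R :=
  \sum_(i < n) ((p.1 \in A i) && (p.2 \in A i))%:R.

Lemma sum_mem2 (R : realFieldType) (T : finType) (B : {set T}) :
  \sum_(p : T * T) ((p.1 \in B) && (p.2 \in B))%:R = #|B|%:R ^+ 2 :> R.
Proof.
have -> : #|B|%:R = \sum_x (x \in B)%:R :> R.
  by rewrite -natr_sum -sum1_card big_mkcond.
rewrite expr2 big_distrlr /= -(pair_bigA _ (fun x y => ((x \in B) && (y \in B))%:R)) /=.
by apply: eq_bigr => x _; apply: eq_bigr => y _; rewrite -natrM mulnb.
Qed.

Lemma sum_hits (R : realFieldType) (T : finType) (n : nat)
    (A : 'I_n -> {set T}) (a : R) :
  (forall i, #|A i|%:R = a) ->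
  \sum_p hits R A p = n%:R * a ^+ 2.
Proof.
move=> cardA; rewrite exchange_big /=; under eq_bigr do rewrite sum_mem2 cardA.
by rewrite sumr_const card_ord mulr_natl.
Qed.

Lemma card_near_diag n (i : 'I_n) :
  (#|[pred j : 'I_n | ~~ (i.+1 < j)%N && ~~ (j.+1 < i)%N]| <= 3)%N.
Proof.
(* The window is [i-1, i, i+1]; at [i = 0] truncation turns it into [0, 1, 2], which still contains
   all neighbours. *)
rewrite cardE -(size_map val) -(size_iota i.-1 3); apply: uniq_leq_size.
  by rewrite (map_inj_uniq val_inj) enum_uniq.
move=> k /mapP[j]; rewrite mem_enum inE => ij ->; rewrite mem_iota /=; lia.
Qed.

(** The square expands into a sum over pairs of indices. At most [3n] pairs are equal or adjacent,
    each contributing at most [a^2]; the others, at most [n^2], contribute at most [b^2] each. *)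
Lemma sum_hits_sqr (R : realFieldType) (T : finType) (n : nat)
    (A : 'I_n -> {set T}) (a b : R) :
  (forall i, #|A i|%:R = a) ->
  (forall i j : 'I_n, (i.+1 < j)%N -> #|A i :&: A j|%SET%:R <= b) -> 0 <= b ->
  \sum_p hits R A p ^+ 2 <= 3 * n%:R * a ^+ 2 + n%:R ^+ 2 * b ^+ 2.
Proof.
move=> cardA cardAI b0.
have -> : \sum_p hits R A p ^+ 2 = \sum_(i < n) \sum_(j < n) #|A i :&: A j|%SET%:R ^+ 2.
  under eq_bigr do rewrite expr2 big_distrlr /=.
  rewrite exchange_big /=; apply: eq_bigr => i _.
  rewrite exchange_big /=; apply: eq_bigr => j _.
  rewrite -sum_mem2; apply: eq_bigr => p _; rewrite -natrM mulnb.
  by rewrite !finset.in_setI andbACA.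
have -> : 3 * n%:R * a ^+ 2 + n%:R ^+ 2 * b ^+ 2 =
    \sum_(i < n) (3 * a ^+ 2 + n%:R * b ^+ 2).
  by rewrite sumr_const card_ord -mulr_natl; ring.
apply: ler_sum => i _.
rewrite (bigID [pred j : 'I_n | ~~ (i.+1 < j)%N && ~~ (j.+1 < i)%N]) /=.
apply: lerD.
  apply: (@le_trans _ _ (\sum_(j < n | ~~ (i.+1 < j)%N && ~~ (j.+1 < i)%N) a ^+ 2)).
    apply: ler_sum => j _; rewrite -(cardA i) ler_sqr ?nnegrE ?ler0n // ler_nat.
    by rewrite subset_leq_card // subsetIl.
  rewrite sumr_const -[_ *+ #|_|]mulr_natl ler_wpM2r ?sqr_ge0 // ler_nat.
  exact: card_near_diag.
apply: (@le_trans _ _ (\sum_(j < n) b ^+ 2)); last first.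
  by rewrite sumr_const card_ord mulr_natl.
rewrite [leRHS](bigID [pred j : 'I_n | ~~ (i.+1 < j)%N && ~~ (j.+1 < i)%N]) /=.
rewrite -[leLHS]add0r; apply: lerD; first by apply: sumr_ge0 => j _; rewrite sqr_ge0.
apply: ler_sum => j; rewrite negb_and !negbK => /orP[ij|ji].
  by rewrite ler_sqr ?nnegrE ?ler0n // cardAI.
by rewrite ler_sqr ?nnegrE ?ler0n // finset.setIC cardAI.
Qed.

(* Chebyshev's inequality for [hits] around its mean [n a^2 / #|T|^2], multiplied out. *)
Lemma card_no_hit_le (R : realFieldType) (T : finType) (n : nat)
    (A : 'I_n -> {set T}) (a b : R)
    (N : {set T * T}) :
  (forall i, #|A i|%:R = a) ->
  (forall i j : 'I_n, (i.+1 < j)%N -> #|A i :&: A j|%SET%:R <= b) -> 0 <= b -> (0 < #|T|)%N ->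
  (forall p, p \in N -> forall i, ~~ ((p.1 \in A i) && (p.2 \in A i))) ->
  #|N|%:R * (n%:R * a ^+ 2 / #|T|%:R ^+ 2) ^+ 2 <=
  3 * n%:R * a ^+ 2 + n%:R ^+ 2 * b ^+ 2 - (n%:R * a ^+ 2) ^+ 2 / #|T|%:R ^+ 2.
Proof.
move=> cardA cardAI b0 T0 NP; set c : R := #|T|%:R; set mu := n%:R * a ^+ 2 / c ^+ 2.
have c0 : c != 0 by rewrite pnatr_eq0 -lt0n.
have hits0 p : p \in N -> hits R A p = 0.
  by move=> /NP pN; rewrite /hits big1 // => i _; rewrite (negbTE (pN i)).
apply: (@le_trans _ _ (\sum_p (hits R A p - mu) ^+ 2)).
  rewrite (bigID (mem N)) /= -[leLHS]addr0; apply: lerD; last first.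
    by apply: sumr_ge0 => p _; rewrite sqr_ge0.
  rewrite (eq_bigr (fun=> mu ^+ 2)) => [|p /hits0->]; last by rewrite sub0r sqrrN.
  by rewrite sumr_const mulr_natl.
have -> : \sum_p (hits R A p - mu) ^+ 2 =
    \sum_p hits R A p ^+ 2 - 2 * mu * \sum_p hits R A p + mu ^+ 2 * c ^+ 2.
  under eq_bigr do rewrite sqrrB.
  rewrite big_split /= sumrB; congr (_ - _ + _).
    by rewrite mulr_sumr; apply: eq_bigr => p _; rewrite -mulr_natl; ring.
  by rewrite sumr_const card_prod -[LHS]mulr_natl natrM -/c; ring.
(* Since [mu * c^2 = n a^2], the cross term and the constant term add up to [-(n a^2)^2 / c^2]. *)
rewrite (sum_hits cardA) -addrA lerD ?(sum_hits_sqr cardA cardAI) //.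
by rewrite le_eqVlt; apply/orP; left; apply/eqP; rewrite /mu; field.
Qed.

(** * Bounding the number of irreducible pairs by Catalan ratios *)

Lemma card_iterate_catalan (R : realType) n : #|{: iterate n}|%:R = catalan R n.
Proof. by rewrite /catalan -card_iterateE natrM mulKf // pnatr_eq0. Qed.

Lemma catalan_gt0 (R : realType) n : 0 < catalan R n.
Proof.
by rewrite /catalan mulr_gt0 ?invr_gt0 ?ltr0n // bin_gt0; lia.
Qed.

Lemma num_irreducible_le (R : realType) n : (0 < n)%N ->
  (num_irreducible n)%:R * (n%:R * catalan R n.-1 ^+ 2 / catalan R n ^+ 2) ^+ 2 <=
  3 * n%:R * catalan R n.-1 ^+ 2 + n%:R ^+ 2 * catalan R n.-2 ^+ 2 -
  (n%:R * catalan R n.-1 ^+ 2) ^+ 2 / catalan R n ^+ 2.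
Proof.
move=> n0; rewrite -!card_iterate_catalan.
(* Ordinals start at 0 and the lines of the tableau at 1, hence the shift. *)
apply: (@card_no_hit_le _ _ n (fun i => lineA n i.+1)).
- by move=> i; rewrite card_lineA // ltn_ord.
- by move=> i j ij; rewrite ler_nat card_lineAI.
- by rewrite ler0n.
- by rewrite -(ltn_pmul2l (ltn0Sn n)) card_iterateE muln0 bin_gt0; lia.
move=> [J K]; rewrite inE /= => JK i; apply: contra JK => JK.
apply/hasP; exists (lineA n i.+1) => //; rewrite mem_cat; apply/orP; left.
by apply/mapP; exists i.+1 => //; rewrite mem_iota; have := ltn_ord i; lia.
Qed.

Lemma catalan_rec (R : realType) n :
  (n%:R + 2) * catalan R n.+1 = (4 * n%:R + 2) * catalan R n.
Proof.
rewrite -!card_iterate_catalan -natrD -natrM addn2 card_iterate_rec.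
by rewrite natrM natrD natrM.
Qed.

(** The recurrence makes the Catalan ratios rational in [n]. Dividing the Chebyshev bound by
    [(n p^2)^2] leaves [S_n^2 (3 / (n p^2) + r^2 - 1)], with [p] and [r] as set in the proof, and
    both summands are [O(1/n)]. *)
Lemma num_irreducible_le_catalan (R : realType) n : (1 < n)%N ->
  (num_irreducible n)%:R <= 57 / n%:R * catalan R n ^+ 2.
Proof.
case: n => [|[|n]] // _; set m := n.+2; have := @num_irreducible_le R m isT; rewrite /=.
have := catalan_rec R n; have := catalan_rec R n.+1; rewrite -/m.
have := catalan_gt0 R n; have := catalan_gt0 R n.+1; have := catalan_gt0 R m.
have mE : m%:R = n%:R + 2 :> R by rewrite -natrD addn2.
have -> : n.+1%:R = n%:R + 1 :> R by rewrite -natr1.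
rewrite mE; have := ler0n R n; move: n%:R (catalan R m) (catalan R n.+1) (catalan R n).
move: (num_irreducible m)%:R => N x c a b x0 c0 a0 b0 ca ab.
have -> : b = (x + 2) * a / (4 * x + 2) by rewrite ab; field; lra.
have -> : a = (x + 3) * c / (4 * x + 6).
  have -> : (x + 3) * c = (4 * (x + 1) + 2) * a by rewrite -ca; ring.
  by field; lra.
(* With [x = n - 2], [p = a / c] is [S_(n-1) / S_n] and [r = b c / a^2]; 57 is [48 + 9],
   from [3 / p^2 <= 48] and [n (r^2 - 1) <= 9]. *)
set p := (x + 3) / (4 * x + 6); set r := 1 + 6 / ((4 * x + 2) * (x + 3)).
have -> : (x + 3) * c / (4 * x + 6) = p * c by rewrite /p; ring.
have -> : (x + 2) * (p * c) / (4 * x + 2) = r * p ^+ 2 * c.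
  by rewrite /r /p; field; apply/andP; split; lra.
have p0 : 4^-1 <= p by rewrite ler_pdivlMr; lra.
have r1 : 0 <= r - 1 by rewrite /r addrAC subrr add0r divr_ge0 ?mulr_ge0 //; lra.
have r2 : (r - 1) * (x + 2) <= 3.
  by rewrite /r addrAC subrr add0r mulrAC ler_pdivrMr ?mulr_gt0 //; nra.
(* Equality holds at [x = 0]. Then [r + 1 <= 3], and with [r2] this gives the constant 9 of [rr]. *)
have r3 : r <= 3 - 1.
  rewrite /r -lerBrDl ler_pdivrMr ?mulr_gt0 //; nra.
have rr : (x + 2) * (r ^+ 2 - 1) <= 9.
  have -> : (x + 2) * (r ^+ 2 - 1) = (r - 1) * (x + 2) * (r + 1) by ring.
  have : 0 <= (r - 1) * (x + 2) by rewrite mulr_ge0 //; lra.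
  by move: r2; move: ((r - 1) * (x + 2)) => y; nra.
have p2 : 16^-1 <= p ^+ 2 by nra.
have w0 : 0 < ((x + 2) * p ^+ 2) ^+ 2 by rewrite exprn_gt0 // mulr_gt0 //; nra.
have -> : (x + 2) * (p * c) ^+ 2 / c ^+ 2 = (x + 2) * p ^+ 2 by field; lra.
move=> le_N; rewrite -(ler_pM2r w0); apply: le_trans le_N _.
have -> : ((x + 2) * (p * c) ^+ 2) ^+ 2 / c ^+ 2 = (x + 2) ^+ 2 * p ^+ 4 * c ^+ 2.
  by field; lra.
rewrite -subr_ge0.
have -> : 57 / (x + 2) * c ^+ 2 * ((x + 2) * p ^+ 2) ^+ 2 -
   (3 * (x + 2) * (p * c) ^+ 2 + (x + 2) ^+ 2 * (r * p ^+ 2 * c) ^+ 2 -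
    (x + 2) ^+ 2 * p ^+ 4 * c ^+ 2) =
   (x + 2) * p ^+ 2 * c ^+ 2 * ((57 - (x + 2) * (r ^+ 2 - 1)) * p ^+ 2 - 3).
  by field; lra.
apply: mulr_ge0.
  by apply/mulr_ge0/sqr_ge0/mulr_ge0/sqr_ge0; lra.
(* The constants fit exactly: [(57 - 9) / 16 = 3]. *)
move: rr p2; move: ((x + 2) * (r ^+ 2 - 1)) (p ^+ 2) => y z; nra.
Qed.

(** * The error factor and the conclusion *)

Lemma error_factor_ge_inv (R : realType) n : (1024 <= n)%N ->
  n%:R^-1 <= `| (n%:R + 2) / n%:R * expR (- (n%:R / 16)) - 2 / n%:R | :> R.
Proof.
move=> n_ge; have : 1024 <= n%:R :> R by rewrite ler_nat.
move: n%:R => x x_ge; have x0 : 0 < x by lra.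
have e_ge : x + 2 <= expR (x / 16).
  (* Squaring the linear bound at [x / 32] gives [1 + x / 16 + x^2 / 1024]; the last term is at
     least [x] once [x >= 1024], which explains the threshold. *)
  have -> : x / 16 = x / 32 + x / 32 by field.
  rewrite expRD; have := expR_ge1Dx (x / 32); move: (expR _) => y y_ge; nra.
have e_le : (x + 2) * expR (- (x / 16)) <= 1.
  by rewrite expRN ler_pdivrMr ?expR_gt0 // mul1r.
(* The exponential term is at most [1 / x], so [2 / x] dominates and the difference is taken in the
   positive order. *)
rewrite distrC.
have -> : 2 / x - (x + 2) / x * expR (- (x / 16)) =
          (2 - (x + 2) * expR (- (x / 16))) / x by field; lra.
rewrite (le_trans _ (ler_norm _)) // ler_pdivlMr // mulVf; lra.
Qed.

Local Open Scope classical_set_scope.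

Theorem mainTheorem1 (R : realType) :
  (fun n : nat => (num_irreducible n)%:R : R^o) =O_\oo
  (fun n : nat =>
     `| (n%:R + 2) / n%:R * expR (- (n%:R / 16)) - 2 / n%:R |
       * catalan R n ^+ 2 : R^o).
Proof.
apply/eqO_exP; exists 57 => //; near=> n.
have n_ge : (1024 <= n)%N by near: n; exact: nbhs_infty_ge.
rewrite ger0_norm ?ler0n // normrM normr_id (ger0_norm (sqr_ge0 _)).
apply: le_trans (num_irreducible_le_catalan R _) _; first by lia.
by rewrite [leRHS]mulrA ler_wpM2r ?sqr_ge0 // ler_pM2l // error_factor_ge_inv.
Unshelve. all: by end_near.
Qed.
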